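(* Let $p$ be a prime, $N=p^e$ with $e\ge1$, and $\Lambda_N(U)=U(U-1)^{N-1}\in\mathbb F_p[U]$. Let $Q=p^m$ with $m\ge1$ and $Q\ge N$, and put $s=p^{\gcd(e,m)}$. Then $$\left(Q-\left\lceil\frac{Q-1}{N}\right\rceil\right)-\#\Lambda_N(\mathbb F_Q)=\frac Qs-\left\lceil\frac{Q-1}{N}\right\rceil.$$ This quantity is zero if and only if $\mathbb F_N\subseteq\mathbb F_Q$.
   Context: All finite fields of characteristic $p$ are regarded as subfields of a fixed algebraic closure $\overline{\mathbb F}_p$, so $\mathbb F_N\subseteq\mathbb F_Q$ means $e\mid m$. $\Lambda_N(\mathbb F_Q)$ denotes the image of $\Lambda_N$ on $\mathbb F_Q$. *)

(* Defs.v *)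
From HB Require Import structures.
From mathcomp Require Export all_boot all_order all_algebra.
From mathcomp Require Export finmap.

Set Implicit Arguments.
Unset Strict Implicit.
Unset Printing Implicit Defensive.

Import GRing.Theory.
Local Open Scope ring_scope.

(* [K] together with [iota] is an algebraic closure of [F]. *)
Definition is_alg_closure (F : fieldType) (K : closedFieldType)
    (iota : {rmorphism F -> K}) : Prop :=
  forall z : K, algebraicOver iota z.

(* In an algebraic closure of 'F_p there is exactly one [A] with
   [is_subfield_of_card q A] when q = p ^ k with k >= 1; that [A] is F_q.
   Since 0^-1 = 0, [divring_closed] on a field says "is a subfield". *)
Definition is_subfield_of_card (K : fieldType) (q : nat) (A : {fset K}) : Prop :=
  divring_closed (mem A) /\ #|` A|%fset = q.

Definition Lambda (p N : nat) : {poly 'F_p} := 'X * ('X - 1) ^+ (N - 1).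

Definition poly_image (F K : fieldType) (iota : {rmorphism F -> K})
    (f : {poly F}) (A : {fset K}) : {fset K} :=
  [fset (map_poly iota f).[x] | x in A]%fset.

Definition ceil_quotient (Q N : nat) : int :=
  Num.ceil ((Q%:R - 1) / N%:R : rat).

(* Main.v *)
(* Write A = F_Q, let B = {x in A | x^N = x}, a field with s elements, and let V
   be the image of the additive map z |-> z^N - z on A.  The fibres of this map
   are cosets of B, so #V = Q/s.  For c <> 0, dividing Lambda_N(x + 1) = x^N + x^(N-1) = c
   by x^N and putting y = 1/x turns it into c y^N - y = 1, which has a solution unless
   y |-> c y^N - y has a kernel, that is, unless c = a^(N-1); in that case it
   says that a lies in V.  Hence the elements of A missed by Lambda_N are the
   a^(N-1) with a in A \ V.  The fibres of a |-> a^(N-1) there are cosets of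
   B \ {0}, so (Q - Q/s)/(s - 1) = Q/s elements are missed.  Finally
   ceil((Q - 1)/N) = Q/N, and s = N exactly when B is all of F_N. *)
Require Import Defs.
From mathcomp Require Import all_boot all_order all_algebra.
From mathcomp Require Import finmap.
From mathcomp Require Import separable.
From mathcomp Require Import zify ring lra.

Set Implicit Arguments.
Unset Strict Implicit.
Unset Printing Implicit Defensive.

Import GRing.Theory Num.Theory.
Local Open Scope ring_scope.

(** * Counting in finite sets *)

Lemma card_imfset_fibres (T T' : choiceType) (f : T -> T') (A : {fset T})
    (k : nat) :
    (forall x, x \in A -> #|` [fset y in A | f y == f x]%fset| = k) ->
  #|` A| = (k * #|` [fset f x | x in A]%fset|)%N.
Proof.
move=> hk; rewrite card_fset_sum1 (partition_big_imfset _ f).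
rewrite -[#|` [fset f x | x in A]%fset|]muln1 card_fset_sum1 muln1 big_distrr /=.
apply: eq_big_seq => _ /imfsetP[x /= xA ->]; rewrite muln1 -(hk x xA).
by rewrite card_fset_sum1 big_fset_condE.
Qed.

(** Pigeonhole. It serves for multiplication by a nonzero element and for the additive map
    [y |-> c * y ^+ N - y]. *)
Lemma injective_fset_surj (T : choiceType) (f : T -> T) (A : {fset T}) :
    {in A, forall x, f x \in A} -> {in A &, injective f} ->
  [fset f x | x in A]%fset = A.
Proof.
move=> fA f_inj; apply/eqP; rewrite eqEfcard card_in_imfset // leqnn andbT.
by apply/fsubsetP => _ /imfsetP[x /= xA ->]; exact: fA.
Qed.

(** * Finite subfields as root sets of ['X^q - 'X] *)

Section FiniteSubfield.

Variables (F : fieldType) (A : {fset F}).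
Hypothesis hA : GRing.divring_closed (mem A).

Lemma subfield_mem1 : 1 \in A. Proof. by case: hA. Qed.

Lemma subfield_memB x y : x \in A -> y \in A -> x - y \in A.
Proof. by case: hA => _ hB _; exact: hB. Qed.

Lemma subfield_mem_div x y : x \in A -> y \in A -> x / y \in A.
Proof. by case: hA => _ _; apply. Qed.

Lemma subfield_mem0 : 0 \in A.
Proof. by have := subfield_memB subfield_mem1 subfield_mem1; rewrite subrr. Qed.

Lemma subfield_memV x : x \in A -> x^-1 \in A.
Proof. by move=> xA; rewrite -div1r subfield_mem_div ?subfield_mem1. Qed.

Lemma subfield_memD x y : x \in A -> y \in A -> x + y \in A.
Proof.
by move=> xA yA; rewrite -(opprK y) -[- y]sub0r !subfield_memB ?subfield_mem0.
Qed.

Lemma subfield_memM x y : x \in A -> y \in A -> x * y \in A.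
Proof.
by move=> xA yA; rewrite -(invrK y) subfield_mem_div ?subfield_memV.
Qed.

Lemma subfield_memX x n : x \in A -> x ^+ n \in A.
Proof.
by move=> xA; elim: n => [|n IH]; rewrite ?expr0 ?subfield_mem1 // exprS subfield_memM.
Qed.

(** Multiplication by a nonzero [x] permutes the nonzero elements of [A]; comparing their products
    before and after shows that [x] to their number is 1. *)
Lemma subfield_expr_card x : x \in A -> x ^+ #|` A| = x.
Proof.
move=> xA; have [->|x0] := eqVneq x 0.
  (* Since [0 ^+ 0 = 1], this case needs [A] to be nonempty. *)
  by rewrite expr0n cardfs_eq0; case: eqP subfield_mem0 => // ->; rewrite in_fset0.
have prodA : \prod_(y <- A | y != 0) y = \prod_(y <- A | y != 0) (x * y).
  rewrite -[in LHS](@injective_fset_surj _ ( *%R x) A); last 2 first.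
  - by move=> y yA; exact: subfield_memM.
  - by move=> y z _ _; exact: mulfI.
  rewrite big_mkcond big_imfset /=; last by move=> y z _ _; exact: mulfI.
  rewrite -big_mkcond /=.
  by apply: eq_bigl => y; rewrite mulf_eq0 negb_or x0.
have nz : \prod_(y <- A | y != 0) y != 0.
  by rewrite prodf_seq_neq0; apply/allP => y _ /=; exact/implyP.
move: prodA; rewrite big_split /= -[LHS]mul1r => /(mulIf nz).
rewrite big_const_seq iter_mulr_1 => /esym xk.
have -> : #|` A| = (count (fun y => y != 0) A).+1.
  rewrite -(count_predC (fun y => y != 0) A) -addn1; congr addn.
  rewrite (eq_count (a2 := pred1 0)); last by move=> y /=; rewrite negbK.
  by rewrite count_uniq_mem ?fset_uniq // subfield_mem0.
by rewrite exprS xk mulr1.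
Qed.

(** The elements of [A] are already [#|A|] roots of ['X^#|A| - 'X]; a root outside [A] would be one
    more than the degree allows. *)
Lemma mem_subfield_expr_card x : (x \in A) = (x ^+ #|` A| == x).
Proof.
apply/idP/eqP => [|xQ]; first exact: subfield_expr_card.
apply: contraT => xA.
have Agt1 : (1 < #|` A|)%N.
  have := @fsubset_leq_card _ [fset 0; 1]%fset A.
  rewrite cardfs2 eq_sym oner_neq0; apply.
  by apply/fsubsetP => y; rewrite !inE => /orP[] /eqP->;
    [exact: subfield_mem0 | exact: subfield_mem1].
have szP : size ('X^#|` A| - 'X : {poly F}) = #|` A|.+1.
  by rewrite size_polyDl size_polyXn // size_polyN size_polyX ltnS.
have := @max_poly_roots _ ('X^#|` A| - 'X : {poly F}) (x :: A).
rewrite szP -size_poly_eq0 szP /= xA fset_uniq ltnn => -> //.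
rewrite rootE !hornerE xQ subrr eqxx /=.
by apply/allP => y yA; rewrite rootE !hornerE subfield_expr_card // subrr.
Qed.

End FiniteSubfield.

(** * Iterates of Frobenius and their fixed points *)

Section FrobeniusPowers.

Variables (R : comNzRingType) (p : nat).
Implicit Types x y : R.

Lemma expr_pX_add x y e : p \in [pchar R] ->
  (x + y) ^+ (p ^ e) = x ^+ (p ^ e) + y ^+ (p ^ e).
Proof.
by move=> charR; rewrite exprDn_pchar // pnatX pnatE ?charR ?(pcharf_prime charR).
Qed.

Lemma expr_pX_sub x y e : p \in [pchar R] ->
  (x - y) ^+ (p ^ e) = x ^+ (p ^ e) - y ^+ (p ^ e).
Proof.
by move=> charR; apply: (addIr (y ^+ (p ^ e))); rewrite -expr_pX_add ?subrK.
Qed.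

Lemma expr_pX_iter x e k : x ^+ (p ^ e) = x -> x ^+ (p ^ (k * e)) = x.
Proof.
by move=> xe; elim: k => [|k IH]; rewrite ?expr1 // mulSn expnD exprM xe.
Qed.

(** Bezout in the exponents of [p]: for [u * e = v * m + gcdn e m], apply Frobenius [u * e] times,
    of which [v * m] act trivially on [x]. *)
Lemma expr_pX_gcdn x e m : (0 < e)%N ->
  x ^+ (p ^ gcdn e m) = x <-> x ^+ (p ^ e) = x /\ x ^+ (p ^ m) = x.
Proof.
move=> e0; split=> [xg|[xe xm]].
  by split; [rewrite -(divnK (dvdn_gcdl e m)) | rewrite -(divnK (dvdn_gcdr e m))];
    exact: expr_pX_iter.
have [u v uv _] := egcdnP m e0.
have := expr_pX_iter u xe.
by rewrite uv expnD exprM (expr_pX_iter v xm).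
Qed.

End FrobeniusPowers.

(** The polynomial splits over [K], and its derivative is the constant -1, so its roots are
    distinct. *)
Lemma pX_roots (K : closedFieldType) (p k : nat) :
    p \in [pchar K] -> (0 < k)%N ->
  {r : seq K | uniq r /\ size r = (p ^ k)%N & r =i [pred x | x ^+ (p ^ k) == x]}.
Proof.
move=> charK k0; have p1 := prime_gt1 (pcharf_prime charK).
have pk1 : (1 < p ^ k)%N by rewrite (leq_ltn_trans k0) // ltn_expl.
pose P : {poly K} := 'X^(p ^ k) - 'X.
have szP : size P = (p ^ k).+1.
  by rewrite size_polyDl size_polyXn // size_polyN size_polyX ltnS.
have lP : lead_coef P = 1.
  by rewrite lead_coefDl ?lead_coefXn // size_polyXn size_polyN size_polyX ltnS.
have [r] := closed_field_poly_normal P; rewrite lP scale1r => rP.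
exists r; last first.
  by move=> x; rewrite -root_prod_XsubC -rP inE rootE !hornerE subr_eq0.
split; last by apply: succn_inj; rewrite -szP rP size_prod_XsubC.
rewrite -separable_prod_XsubC -rP unlock derivB derivXn derivX.
have -> : 'X^((p ^ k).-1) *+ (p ^ k) = 0 :> {poly K}.
  by rewrite -mulr_natr -polyC_natr natrX (pcharf0 charK) expr0n gtn_eqF ?mulr0.
by rewrite sub0r -scaleN1r coprimepZr ?oppr_eq0 ?oner_eq0 // coprimep1.
Qed.

(** * The elements of the subfield missed by the polynomial *)

Section LambdaImage.

Variables (K : closedFieldType) (p e m : nat) (A : {fset K}).
Hypotheses (charK : p \in [pchar K]) (e0 : (0 < e)%N).
Hypotheses (hA : GRing.divring_closed (mem A)) (cardA : #|` A| = (p ^ m)%N).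

Local Notation N := (p ^ e)%N.
Local Notation s := (p ^ gcdn e m)%N.
Local Notation B := ([fset x in A | x ^+ N == x]%fset).
Local Notation V := ([fset z ^+ N - z | z in A]%fset).
Local Notation Lam := ([fset x * (x - 1) ^+ (N - 1) | x in A]%fset).

Lemma pgt1 : (1 < p)%N. Proof. exact: prime_gt1 (pcharf_prime charK). Qed.

Lemma Ngt1 : (1 < N)%N.
Proof. by rewrite (leq_ltn_trans e0) // ltn_expl ?pgt1. Qed.

Lemma exprN_rec (x : K) : x ^+ N = x * x ^+ (N - 1).
Proof. by rewrite -exprS subn1 prednK // ltnW ?Ngt1. Qed.

Lemma exprN1_0 : 0 ^+ (N - 1) = 0 :> K.
Proof. by rewrite expr0n subn_eq0 leqNgt Ngt1. Qed.

Lemma expfN1_eq1 (x : K) : x != 0 -> (x ^+ (N - 1) == 1) = (x ^+ N == x).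
Proof. by move=> x0; rewrite exprN_rec -[X in _ = (_ == X)]mulr1 (inj_eq (mulfI x0)). Qed.

(** Membership in [A] means [x ^+ (p ^ m) = x], so [B] consists of all common fixed points of two
    Frobenius powers, that is, of all roots of ['X^s - 'X] in [K]. *)
Lemma card_frobenius_fixed : #|` B| = s.
Proof.
have g0 : (0 < gcdn e m)%N by rewrite gcdn_gt0 e0.
have [r [ur sr] rE] := pX_roots charK g0.
rewrite -sr -(undup_id ur) -card_fseq; congr (#|` _|); apply/fsetP => x.
rewrite !inE rE inE (mem_subfield_expr_card hA) cardA.
by apply/andP/eqP => [[/eqP xm /eqP xe]|/(expr_pX_gcdn _ _ _ e0)[-> ->] //];
  apply/(expr_pX_gcdn _ _ _ e0).
Qed.

Lemma card_artin_schreier_image : #|` A| = (s * #|` V|)%N.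
Proof.
apply: card_imfset_fibres => x xA; rewrite -card_frobenius_fixed.
transitivity #|` [fset (x + b)%R | b in B]%fset|;
  last by rewrite card_imfset //; exact: addrI.
congr (#|` _|).
apply/fsetP => y; rewrite !inE; apply/andP/imfsetP => [[yA /eqP yx]|[b /=]].
  exists (y - x) => /=; last by rewrite addrC subrK.
  rewrite !inE subfield_memB // expr_pX_sub //=.
  by rewrite -subr_eq0; apply/eqP; move: yx => /(congr1 (fun t => t - (x ^+ N - x)));
    rewrite subrr => <-; ring.
rewrite !inE => /andP[bA /eqP bN] ->; split; first exact: subfield_memD.
by rewrite expr_pX_add // bN; apply/eqP; ring.
Qed.

Lemma frobenius_fixed_nz : #|` B `\ 0|%fset = (s - 1)%N.
Proof.
have := cardfsD1 0 B; rewrite card_frobenius_fixed => ->.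
by rewrite !inE subfield_mem0 // expr0n gtn_eqF ?(ltnW Ngt1) // eqxx addKn.
Qed.

(** The map [z |-> z ^+ N - z] is linear over [B]. Hence nonzero elements of [B] also preserve the
    complement of [V], which keeps whole cosets inside the fibres counted below. *)
Lemma artin_schreier_image_scale b v :
  b \in A -> b ^+ N = b -> v \in V -> b * v \in V.
Proof.
move=> bA bN /imfsetP[z /= zA ->]; apply/imfsetP; exists (b * z) => /=.
  exact: subfield_memM.
by rewrite exprMn bN mulrBr.
Qed.

Lemma artin_schreier_image_sub : (V `<=` A)%fset.
Proof.
apply/fsubsetP => _ /imfsetP[z /= zA ->].
by rewrite subfield_memB ?subfield_memX.
Qed.

Lemma Lambda_image_sub : (Lam `<=` A)%fset.
Proof.
apply/fsubsetP => _ /imfsetP[z /= zA ->].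
by rewrite subfield_memM ?subfield_memX ?subfield_memB ?subfield_mem1.
Qed.

Lemma artin_schreier_nonimage_neq0 x : x \notin V -> x != 0.
Proof.
apply: contraNneq => ->; apply/imfsetP; exists 0; first exact: subfield_mem0.
by rewrite expr0n gtn_eqF ?(ltnW Ngt1) ?subr0.
Qed.

Lemma card_Lambda_nonimage_fibres :
  #|` (A `\` V)%fset| =
  ((s - 1) * #|` [fset x ^+ (N - 1) | x in (A `\` V)%fset]%fset|)%N.
Proof.
apply: card_imfset_fibres => x; rewrite inE => /andP[xV xA].
have x0 := artin_schreier_nonimage_neq0 xV.
rewrite -frobenius_fixed_nz.
transitivity #|` [fset b * x | b in (B `\ 0)%fset]%fset|;
  last by rewrite card_imfset //; exact: mulIf.
congr (#|` _|); apply/fsetP => y; rewrite !inE.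
apply/andP/imfsetP => [[/andP[yV yA] /eqP yx]|[b /=]].
  have y0 := artin_schreier_nonimage_neq0 yV.
  exists (y / x) => /=; last by rewrite divfK.
  rewrite !inE mulf_neq0 ?invr_eq0 //= subfield_mem_div //=.
  rewrite -expfN1_eq1 ?mulf_neq0 ?invr_eq0 //.
  by rewrite expr_div_n yx divff // expf_neq0.
rewrite !inE => /and3P[b0 bA bN] ->; rewrite (subfield_memM hA) // andbT.
move: (bN); rewrite -expfN1_eq1 // exprMn => /eqP ->; rewrite mul1r.
split=> //; apply: contra xV => bxV.
rewrite -[x](mulKf b0); apply: artin_schreier_image_scale => //.
  exact: subfield_memV.
by rewrite exprVn (eqP bN).
Qed.

Lemma Lambda_nonimage :
  (A `\` Lam)%fset = [fset x ^+ (N - 1) | x in (A `\` V)%fset]%fset.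
Proof.
apply/fsetP => c; rewrite inE; apply/andP/imfsetP => [[cL cA]|[x /=]]; last first.
  rewrite inE => /andP[xV xA] ->; split; last exact: subfield_memX.
  have x0 := artin_schreier_nonimage_neq0 xV.
  apply: contra xV => /imfsetP[u /= uA ux].
  have w0 : u - 1 != 0.
    by apply: contraNneq (expf_neq0 (N - 1) x0) => w0; rewrite ux w0 exprN1_0 mulr0.
  (* With [z = x / (u - 1)], the relation [x ^+ (N - 1) = u * (u - 1) ^+ (N - 1)] gives
     [z ^+ N = x * u / (u - 1)], whence [z ^+ N - z = x]. *)
  apply/imfsetP; exists (x / (u - 1)) => /=.
    by rewrite subfield_mem_div ?subfield_memB ?subfield_mem1.
  rewrite exprN_rec expr_div_n ux mulfK ?expf_neq0 //.
  by field.
(* Zero is attained, at the point 1. *)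
have c0 : c != 0.
  apply: contraNneq cL => ->; apply/imfsetP; exists 1; first exact: subfield_mem1.
  by rewrite subrr exprN1_0 mulr0.
have L1 y : y \in A -> c * y ^+ N - y != 1.
  move=> yA; apply: contra cL => /eqP yc.
  have y0 : y != 0.
    apply: contra_eq_neq yc => ->.
    by rewrite expr0n gtn_eqF ?(ltnW Ngt1) // mulr0 subr0 eq_sym oner_eq0.
  (* The value at [1 + y^-1] is [(y + 1) / y ^+ N], which is [c] when [c * y ^+ N - y = 1]. *)
  apply/imfsetP; exists (1 + y^-1) => /=.
    by rewrite subfield_memD ?subfield_memV ?subfield_mem1.
  rewrite [1 + _]addrC addrK exprVn.
  have yN0 : y ^+ (N - 1) != 0 by exact: expf_neq0.
  apply: (mulIf yN0); rewrite mulfVK //; apply: (mulIf y0).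
  rewrite -mulrA -[_ * y]mulrC -exprN_rec mulrDl mulVf // mul1r -yc.
  by rewrite subrK.
have LA : {in A, forall y, c * y ^+ N - y \in A}.
  by move=> y yA; rewrite subfield_memB ?subfield_memM ?subfield_memX.
have [y /andP[yA y0] yc] : exists2 y, (y \in A) && (y != 0) & c * y ^+ N = y.
  have [/hasP[y yA /andP[y0 /eqP yc]]|/hasPn h] :=
    boolP (has (fun y => (y != 0) && (c * y ^+ N == y)) A).
    by exists y => //; rewrite yA.
  (* In the remaining case y |-> c y^N - y permutes A, so it takes the value 1. *)
  have Linj : {in A &, injective (fun y => c * y ^+ N - y)}.
    move=> y z yA zA /= yz; apply/eqP; rewrite -subr_eq0.
    have := h (y - z); rewrite subfield_memB // => /(_ isT).
    rewrite negb_and negbK expr_pX_sub // => /orP[//|/negP[]].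
    by rewrite -subr_eq0 -[X in _ == X](subrr (c * y ^+ N - y)) {2}yz; apply/eqP; ring.
  have := subfield_mem1 hA; rewrite -(injective_fset_surj LA Linj).
  by case/imfsetP => y /= yA yc; case/eqP: (L1 y yA).
(* A nonzero kernel element [y] supplies the required root [a = y^-1]; it remains to see that [a] is
   outside [V]. *)
have cy : c = y^-1 ^+ (N - 1).
  rewrite exprVn; apply: (mulIf (expf_neq0 (N - 1) y0)); rewrite mulVf ?expf_neq0 //.
  by apply: (mulIf y0); rewrite mul1r -mulrA -[_ * y]mulrC -exprN_rec.
exists y^-1 => //=; rewrite inE (subfield_memV hA) // andbT.
apply: contra cL => /imfsetP[z /= zA yz].
have z0 : z != 0.
  apply: contraNneq y0 => z0; rewrite -invr_eq0 yz z0.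
  by rewrite expr0n gtn_eqF ?(ltnW Ngt1) // subrr.
(* This solves [z = a / (u - 1)] for [u], with [a = y^-1]. As [a = z ^+ N - z], the point is
   [u = z ^+ (N - 1)], and the value there is [a ^+ (N - 1) = c]. *)
apply/imfsetP; exists (1 + y^-1 / z) => /=.
  by rewrite subfield_memD ?subfield_mem1 ?subfield_mem_div ?subfield_memV.
rewrite [1 + _]addrC addrK cy [y^-1 / z + 1](_ : _ = z ^+ (N - 1)); last first.
  by rewrite yz exprN_rec; field.
by rewrite expr_div_n mulrC divfK // expf_neq0.
Qed.

(** The two fibre counts are [a = s * v] and [a - v = (s - 1) * l], with [l] the number of missed
    elements; since [s > 1], the factor [s - 1] cancels and [l = v]. *)
Lemma card_Lambda_nonimage : (s * (#|` A| - #|` Lam|) = #|` A|)%N.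
Proof.
have s1 : (1 < s)%N.
  have g0 : (0 < gcdn e m)%N by rewrite gcdn_gt0 e0.
  by rewrite (leq_ltn_trans g0) // ltn_expl ?pgt1.
have := card_Lambda_nonimage_fibres; rewrite -Lambda_nonimage.
rewrite !cardfsDS ?artin_schreier_image_sub ?Lambda_image_sub //.
have := card_artin_schreier_image.
move: (#|` A|) (#|` V|) (_ - #|` Lam|)%N s s1 => a v l t t1 -> h.
have : ((t - 1) * (t * l) = (t - 1) * (t * v))%N.
  by rewrite mulnCA -h mulnBl mul1n; nia.
by move/eqP; rewrite eqn_pmul2l ?subn_gt0 // => /eqP.
Qed.

End LambdaImage.

(** * The ceiling, the defect and its vanishing *)

Lemma map_Lambda_horner (p N : nat) (K : fieldType)
    (iota : {rmorphism 'F_p -> K}) (x : K) :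
  (map_poly iota (Lambda p N)).[x] = x * (x - 1) ^+ (N - 1).
Proof.
by rewrite /Lambda rmorphM rmorphXn rmorphB rmorph1 /= map_polyX !hornerE.
Qed.

(** Here [(Q - 1) / N] is the integer [Q / N] lowered by [1 / N], which lies strictly between 0 and
    1. *)
Lemma ceil_quotient_expn (p e m : nat) : (1 < p)%N -> (0 < e <= m)%N ->
  ceil_quotient (p ^ m) (p ^ e) = (p ^ (m - e))%N.
Proof.
move=> p1 /andP[e0 em].
have N1 : (1 < p ^ e)%N by rewrite (leq_ltn_trans e0) // ltn_expl.
have N0 : 0 < (p ^ e)%:R :> rat by rewrite ltr0n ltnW.
have N2 : 1 < (p ^ e)%:R :> rat by rewrite ltr1n.
have QE : (p ^ m)%:R = (p ^ (m - e))%:R * (p ^ e)%:R :> rat.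
  by rewrite -natrM -expnD subnK.
apply: ceil_def.
rewrite ltr_pdivlMr // ler_pdivrMr // QE rmorphB /=.
by apply/andP; split; lra.
Qed.

Theorem corollary5p7
    (p e m N Q s : nat)
    (hp : prime p) (he : (1 <= e)%N) (hm : (1 <= m)%N)
    (hN : N = (p ^ e)%N) (hQ : Q = (p ^ m)%N) (hQN : (N <= Q)%N)
    (hs : s = (p ^ gcdn e m)%N)
    (K : closedFieldType) (iota : {rmorphism 'F_p -> K})
    (hK : is_alg_closure iota)
    (FN FQ : {fset K})
    (hFN : is_subfield_of_card N FN) (hFQ : is_subfield_of_card Q FQ) :
  let defect : rat :=
    (Q%:R - (ceil_quotient Q N)%:~R)
      - (#|` poly_image iota (Lambda p N) FQ|%fset)%:R in
  defect = Q%:R / s%:R - (ceil_quotient Q N)%:~R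
  /\ (defect = 0 <-> (FN `<=` FQ)%fset).
Proof.
have p1 := prime_gt1 hp.
have charK : p \in [pchar K] by rewrite (fmorph_pchar iota) pchar_Fp.
case: hFQ => hA cA; case: hFN => hB cB; move: cA cB.
rewrite hN hQ hs => cA cB defect.
have em : (e <= m)%N by move: hQN; rewrite hN hQ leq_exp2l.
have hpow k : (p ^ k)%:R != 0 :> rat by rewrite pnatr_eq0 -lt0n expn_gt0 prime_gt0.
have imE : poly_image iota (Lambda p (p ^ e)) FQ =
    [fset x * (x - 1) ^+ (p ^ e - 1) | x in FQ]%fset.
  by apply/fsetP => c; apply/imfsetP/imfsetP => -[x xA ->]; exists x;
    rewrite ?map_Lambda_horner.
have card_im := card_Lambda_nonimage charK he hA cA.
have le_im := fsubset_leq_card (Lambda_image_sub p e hA).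
have defE : defect = (p ^ m)%:R / (p ^ gcdn e m)%:R
    - (ceil_quotient (p ^ m) (p ^ e))%:~R.
  (* The bound [le_im] ensures that the natural-number subtraction is not truncated, so it passes to
     the rationals. *)
  rewrite /defect imE; move/(congr1 (fun n => n%:R : rat)): card_im.
  by rewrite natrM natrB // cA => card_im;
    rewrite -[in RHS]card_im mulrAC divff // mul1r addrAC.
split=> //; rewrite defE ceil_quotient_expn ?he //.
have gm : (gcdn e m <= m)%N by rewrite dvdn_leq // dvdn_gcdr.
have -> : (p ^ m)%:R / (p ^ gcdn e m)%:R = (p ^ (m - gcdn e m))%:R :> rat.
  apply: (mulIf (hpow (gcdn e m))); rewrite divfK //.
  by rewrite -natrM -expnD subnK.
split=> [/eqP|FNQ].
  (* Vanishing equates the exponents [m - gcdn e m] and [m - e]; both subtractions are exact, so [e]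
     is the gcd, and fixed points of the [e]-th Frobenius power are fixed by the [m]-th. *)
  rewrite subr_eq0 -pmulrn eqr_nat eqn_exp2l // => /eqP eg.
  have ge : gcdn e m = e by lia.
  apply/fsubsetP => x; rewrite (mem_subfield_expr_card hA).
  rewrite (mem_subfield_expr_card hB) cA cB => /eqP xe.
  by have [] := (expr_pX_gcdn p x m he).1; rewrite ?ge // => _ ->.
suff -> : gcdn e m = e by rewrite subrr.
have := card_frobenius_fixed charK he hA cA.
(* Under the inclusion, the fixed points inside [FQ] are all of [FN]; comparing their number [s]
   with [N] identifies the exponents. *)
have -> : [fset x in FQ | x ^+ (p ^ e) == x]%fset = FN.
  apply/fsetP => x; rewrite !inE [in RHS](mem_subfield_expr_card hB) cB.
  apply: andb_idl; rewrite -cB -(mem_subfield_expr_card hB).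
  exact: (fsubsetP FNQ).
by rewrite cB => /eqP; rewrite eqn_exp2l // => /eqP.
Qed.
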